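(* Let $n\ge2$, let $D\subsetneq\mathbb{R}^n$ be a domain and $x\in D$. Let $t>0$ and assume that $1-t\delta_D(x)\neq0$. Then $$B^n(x,r)\subset B_c(x,t)\subset B^n(x,R),$$ where $$r=\frac{t(\delta_D(x))^2}{1+t\delta_D(x)}\qquad\text{and}\qquad R=\frac{t(\delta_D(x))^2}{1-t\delta_D(x)}.$$ The radii $r$ and $R$ are best possible. Moreover, $R/r\to1$ as $t\to0$.
   Context: $|\cdot|$ is the Euclidean norm; $\delta_D(x)=\mathrm{dist}(x,\partial D)$ is the Euclidean distance from $x$ to $\partial D$; $B^n(x,r)=\{y\in\mathbb{R}^n:|x-y|<r\}$. The Cassinian metric on a domain $D\subsetneq\mathbb{R}^n$ is $$c_D(x,y)=\sup_{p\in\partial D}\frac{|x-y|}{|x-p||p-y|},\qquad x,y\in D,$$ the supremum being over the finite boundary points of $D$ (the point $\infty$, if it is a boundary point in $\overline{\mathbb{R}^n}=\mathbb{R}^n\cup\{\infty\}$, contributes $0$), and $B_c(x,t)=\{y\in D:c_D(x,y)<t\}$.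
   Formalization: The outer inclusion and optimality of R are stated only for 1−tδ_D(x)>0 (otherwise R<0, the Euclidean ball is empty and the inclusion fails at x); R is best possible in that some domain D', x' with the same boundary distance attains it, as it is not sharp in every D. *)

(* Defs.v *)
From mathcomp Require Import all_boot all_order all_algebra.
From mathcomp Require Import all_classical all_reals all_analysis.

Set Implicit Arguments.
Unset Strict Implicit.
Unset Printing Implicit Defensive.

Import Order.TTheory GRing.Theory Num.Theory.
Import numFieldNormedType.Exports.

Local Open Scope classical_set_scope.
Local Open Scope ring_scope.

(* The norm `|x| on row vectors is the maximum norm, so the Euclidean norm is
   defined separately. Both norms induce the same topology, so the library's
   open, closure and connected on 'rV[R]_n have their usual meaning. *)
Definition enorm (R : realType) (n : nat) (x : 'rV[R]_n) : R :=
  Num.sqrt (\sum_(i < n) x ord0 i ^+ 2).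

Definition eball (R : realType) (n : nat) (x : 'rV[R]_n) (r : R) :
  set 'rV[R]_n := [set y | enorm (x - y) < r].

Definition frontier (T : topologicalType) (D : set T) : set T :=
  closure D `&` closure (~` D).

Definition proper_domain (R : realType) (n : nat) (D : set 'rV[R]_n) : Prop :=
  [/\ D !=set0, open D, connected D & D != setT].

(* inf and sup of subsets of R are total. Below, for a proper domain D and
   x, y in D, they are taken over nonempty sets, bounded from below,
   respectively from above. *)
Definition bdist (R : realType) (n : nat) (D : set 'rV[R]_n) (x : 'rV[R]_n) :
  R := inf [set enorm (x - p) | p in frontier D].

Definition cassinian (R : realType) (n : nat) (D : set 'rV[R]_n)
  (x y : 'rV[R]_n) : R :=
  sup [set enorm (x - y) / (enorm (x - p) * enorm (p - y)) | p in frontier D].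

Definition cball (R : realType) (n : nat) (D : set 'rV[R]_n) (x : 'rV[R]_n)
  (t : R) : set 'rV[R]_n := [set y | D y /\ cassinian D x y < t].

Definition inner_radius (R : realType) (d t : R) : R :=
  t * d ^+ 2 / (1 + t * d).

Definition outer_radius (R : realType) (d t : R) : R :=
  t * d ^+ 2 / (1 - t * d).

(* Main.v *)
Require Import Defs.
From mathcomp Require Import all_boot all_order all_algebra.
From mathcomp Require Import all_classical all_reals all_analysis.
From mathcomp Require Import ring lra.
Set Implicit Arguments.
Unset Strict Implicit.
Unset Printing Implicit Defensive.

Import Order.TTheory GRing.Theory Num.Theory.
Import numFieldNormedType.Exports.
Local Open Scope classical_set_scope.
Local Open Scope ring_scope.

(** Write [d] for the distance from [x] to the boundary and [s = |x - y|]. A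
boundary point [p] contributes [s / (|x - p| |p - y|)] to the Cassinian metric,
so everything rests on estimates of the two factors of the denominator.

Since [|x - p| >= d] and [|p - y| >= d - s] for every [p], the metric is at most
[s / (d (d - s))] when [s < d]; solving [s / (d (d - s)) < t] for [s] gives
exactly [s < r] ([ltr_inner_radius]), hence the inner inclusion. The boundary is
closed and closed bounded sets are compact, so some boundary point [p] lies at
distance exactly [d] from [x] ([bdist_attained]). For this [p] one has
[|p - y| <= d + s], so the metric is at least [s / (d (d + s))], and solving
[s / (d (d + s)) < t] gives [s < R] ([ltr_outer_radius]), hence the outer
inclusion.

Sharpness means that both estimates can be equalities. On the segment from [x]
to a nearest boundary point [p] one has [|p - y| = d - s], so the point of that
segment at distance [r] from [x] has Cassinian distance at least [t]; this works
in every domain. For the outer radius take a half-space and move from [x] away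
from the bounding hyperplane: with [y] at distance [s] from [x], every boundary
point is at distance at least [d] from [x] and at least [d + s] from [y], both
attained at the foot of the perpendicular, so [y] has Cassinian distance at most
[s / (d (d + s))], which is less than [t] for all [s < R].

Finally [R / r = (1 + t d) / (1 - t d)], which tends to [1]. *)

(** * Euclidean norm on row vectors *)

Lemma sum_sqr_ge0 (R : realType) (n : nat) (x : 'rV[R]_n) :
  0 <= \sum_(i < n) x ord0 i ^+ 2.
Proof. by apply: sumr_ge0 => i _; exact: sqr_ge0. Qed.

Lemma enorm_ge0 (R : realType) (n : nat) (x : 'rV[R]_n) : 0 <= enorm x.
Proof. exact: sqrtr_ge0. Qed.

Lemma sqr_enorm (R : realType) (n : nat) (x : 'rV[R]_n) :
  enorm x ^+ 2 = \sum_(i < n) x ord0 i ^+ 2.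
Proof. by rewrite sqr_sqrtr// sum_sqr_ge0. Qed.

Lemma enormZ (R : realType) (n : nat) (a : R) (x : 'rV[R]_n) :
  enorm (a *: x) = `|a| * enorm x.
Proof.
rewrite /enorm -sqrtr_sqr -sqrtrM ?sqr_ge0// mulr_sumr.
by congr Num.sqrt; apply: eq_bigr => i _; rewrite mxE exprMn.
Qed.

Lemma enormN (R : realType) (n : nat) (x : 'rV[R]_n) : enorm (- x) = enorm x.
Proof. by rewrite -scaleN1r enormZ normrN1 mul1r. Qed.

Lemma enorm_distC (R : realType) (n : nat) (x y : 'rV[R]_n) :
  enorm (x - y) = enorm (y - x).
Proof. by rewrite -enormN opprB. Qed.

Lemma ler_coord_enorm (R : realType) (n : nat) (x : 'rV[R]_n) (i : 'I_n) :
  `|x ord0 i| <= enorm x.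
Proof.
rewrite -sqrtr_sqr ler_wsqrtr// (bigD1 i)//= lerDl.
by apply: sumr_ge0 => j _; exact: sqr_ge0.
Qed.

(** Transfers boundedness for the Euclidean norm to the maximum norm, which is
the one that the compactness criterion speaks of. *)
Lemma ler_mx_norm_enorm (R : realType) (n : nat) (x : 'rV[R]_n) :
  `|x| <= enorm x.
Proof.
rewrite [leLHS]/Num.norm/=.
have [->|/mx_norm_neq0[[i j] ->]] := eqVneq (mx_norm x) 0.
  exact: enorm_ge0.
by rewrite /= (ord1 i); exact: ler_coord_enorm.
Qed.

Lemma enorm_eq0 (R : realType) (n : nat) (x : 'rV[R]_n) : enorm x = 0 -> x = 0.
Proof.
move=> x0; apply/eqP; rewrite -normr_le0 -x0.
exact: ler_mx_norm_enorm.
Qed.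

(** Expanding [0 <= |b^2 x - c y|^2], where [b = |y|] and [c] is the inner
product, gives [c^2 <= |x|^2 |y|^2] after division by [b^2]. *)
Lemma cauchy_schwarz_rV (R : realType) (n : nat) (x y : 'rV[R]_n) :
  \sum_(i < n) x ord0 i * y ord0 i <= enorm x * enorm y.
Proof.
have [y0|y0] := eqVneq (enorm y) 0.
  rewrite y0 (enorm_eq0 y0) mulr0 big1// => i _.
  by rewrite mxE mulr0.
have ygt0 : 0 < enorm y by rewrite lt_neqAle eq_sym y0 enorm_ge0.
set a := enorm x; set b := enorm y; set c := \sum_(i < n) _.
have : 0 <= \sum_(i < n) (b ^+ 2 * x ord0 i - c * y ord0 i) ^+ 2.
  by apply: sumr_ge0 => i _; exact: sqr_ge0.
rewrite (eq_bigr (fun i => b ^+ 4 * x ord0 i ^+ 2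
    - (b ^+ 2 * c *+ 2) * (x ord0 i * y ord0 i) + c ^+ 2 * y ord0 i ^+ 2));
    last by move=> i _; ring.
rewrite big_split /= sumrB -!mulr_sumr -!sqr_enorm -/a -/b -/c.
rewrite (_ : _ + _ = b ^+ 2 * ((a * b) ^+ 2 - c ^+ 2)); last by ring.
rewrite pmulr_rge0 ?exprn_gt0// subr_ge0 => cab.
have ab0 : 0 <= a * b by rewrite mulr_ge0// enorm_ge0.
apply: le_trans (ler_norm c) _; rewrite -(ger0_norm ab0).
by rewrite -ler_sqr ?nnegrE ?normr_ge0// !real_normK ?num_real.
Qed.

Lemma enorm_triangle (R : realType) (n : nat) (x y : 'rV[R]_n) :
  enorm (x + y) <= enorm x + enorm y.
Proof.
rewrite -ler_sqr ?nnegrE ?addr_ge0 ?enorm_ge0// sqrrD !sqr_enorm.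
under eq_bigr do rewrite mxE sqrrD.
rewrite !big_split /= -mulr2n lerD2r lerD2l.
by rewrite lerMn2r/= cauchy_schwarz_rV.
Qed.

Lemma enorm_triangle_dist (R : realType) (n : nat) (x y z : 'rV[R]_n) :
  enorm (x - z) <= enorm (x - y) + enorm (y - z).
Proof. by rewrite -(subrKA y); exact: enorm_triangle. Qed.

Lemma continuous_enorm (R : realType) (n : nat) :
  continuous (@enorm R n).
Proof.
move=> x; apply: (@continuous_comp _ _ _
  (fun x : 'rV[R]_n => \sum_(i < n) x ord0 i ^+ 2) Num.sqrt);
  last exact: sqrt_continuous.
apply: continuous_big => [|i _ y]; first exact: add_continuous.
apply: (@continuous_comp _ _ _ (fun x : 'rV[R]_n => x ord0 i)
  (fun a : R => a ^+ 2)).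
  exact: coord_continuous.
exact: exprn_continuous.
Qed.

Lemma continuous_edist (R : realType) (n : nat) (x : 'rV[R]_n) :
  continuous (fun y : 'rV[R]_n => enorm (x - y)).
Proof.
move=> y; apply: (@continuous_comp _ _ _ (fun y : 'rV[R]_n => x - y));
  last exact: continuous_enorm.
by apply: (@cvgB R 'rV[R]_n _ (nbhs y) _ (fun=> x) id);
  [exact: cvg_cst|exact: cvg_id].
Qed.

(** * Segments and the frontier *)

(** If [A] missed the frontier, [A `&` D] would equal [A `&` closure D], and so
would be both open and closed in [A]. *)
Lemma connected_meets_frontier (T : topologicalType) (D A : set T) :
  open D -> connected A -> A `&` D !=set0 -> A `\` D !=set0 ->
  A `&` frontier D !=set0.
Proof.
move=> oD cA AD0 [y [Ay nDy]]; apply: contrapT => AF.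
suff /(_ _ Ay) [_ //] : A `<=` A `&` D.
rewrite [X in _ `<=` X](cA (A `&` D))//; first by exists D.
exists (closure D); first exact: closed_closure.
apply/seteqP; split=> z [Az Dz]; split=> //; first exact: subset_closure.
apply: contrapT => nDz; apply: AF; exists z; split => //; split => //.
exact: subset_closure.
Qed.

Lemma segment_param_continuous (R : realType) (n : nat) (x y : 'rV[R]_n) :
  continuous (fun s : R => x + s *: (y - x)).
Proof.
move=> s; apply: cvgD; first exact: cvg_cst.
by apply: cvgZr_tmp; exact: cvg_id.
Qed.

Lemma connected_segment (R : realType) (n : nat) (x y : 'rV[R]_n) :
  connected [set x + s *: (y - x) | s in `[0, 1]].
Proof.
apply: connected_continuous_connected; first exact: segment_connected.
exact/continuous_subspaceT/segment_param_continuous.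
Qed.

Lemma segment_meets_frontier (R : realType) (n : nat) (D : set 'rV[R]_n)
    (x y : 'rV[R]_n) : open D -> D x -> ~ D y ->
  exists2 s : R, 0 <= s <= 1 & frontier D (x + s *: (y - x)).
Proof.
move=> oD Dx nDy.
have [||_ [[s s01 <-] Fs]] :=
  connected_meets_frontier oD (@connected_segment R n x y).
- exists x; split=> //; exists 0; first by rewrite /= in_itv/= lexx ler01.
  by rewrite scale0r addr0.
- exists y; split=> //; exists 1; first by rewrite /= in_itv/= lexx ler01.
  by rewrite scale1r subrKC.
- by exists s => //; move: s01; rewrite /= in_itv.
Qed.

Lemma enorm_ray (R : realType) (n : nat) (x v : 'rV[R]_n) (s : R) :
  enorm (x - (x + s *: v)) = `|s| * enorm v.
Proof. by rewrite opprD addNKr enormN enormZ. Qed.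

Lemma frontier_nonempty (R : realType) (n : nat) (D : set 'rV[R]_n) :
  proper_domain D -> frontier D !=set0.
Proof.
move=> [[x Dx] oD _ /eqP DT].
have [y nDy] : exists y, ~ D y.
  by apply/existsNP => DT'; apply: DT; apply/seteqP; split.
by have [s _ Fs] := segment_meets_frontier oD Dx nDy; eexists; exact: Fs.
Qed.

(** * Distance to the boundary *)

Lemma bdist_le (R : realType) (n : nat) (D : set 'rV[R]_n) (x p : 'rV[R]_n) :
  frontier D p -> bdist D x <= enorm (x - p).
Proof.
move=> Fp; apply: ge_inf; last by exists p.
by exists 0 => _ [q _ <-]; exact: enorm_ge0.
Qed.

(** The distance to [x] is continuous, and it has to be minimised only over the
part of the frontier that is no farther from [x] than some frontier point [q];
that part is compact. *)
Lemma bdist_attained (R : realType) (n : nat) (D : set 'rV[R]_n)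
    (x : 'rV[R]_n) : frontier D !=set0 ->
  exists2 p, frontier D p & enorm (x - p) = bdist D x.
Proof.
move=> [q Fq].
pose A := frontier D `&` [set p | enorm (x - p) <= enorm (x - q)].
have cA : compact A.
  apply: bounded_closed_compact.
    exists (`|x| + enorm (x - q)); split; first exact: num_real.
    move=> M ltM p [_ /= xp]; apply: le_trans (ltW ltM).
    rewrite -(subKr x p); apply: le_trans (ler_normB _ _) _.
    by rewrite lerD2l; apply: le_trans xp; exact: ler_mx_norm_enorm.
  apply: closedI; first by apply: closedI; exact: closed_closure.
  apply: (@preimage_closed _ _ (fun p : 'rV[R]_n => enorm (x - p))
    [set r | r <= enorm (x - q)]); last exact: closed_le.
  by move=> p _; exact: continuous_edist.
have [|p /set_mem[Fp xp] minp] :=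
    EVT_min_rV _ cA (continuous_subspaceT (@continuous_edist R n x)).
  by exists q; split => /=.
exists p => //; apply/eqP; rewrite eq_le bdist_le// andbT.
apply: lb_le_inf; first by exists (enorm (x - p)), p.
move=> _ [r Fr <-].
have [xrq|/ltW xqr] := leP (enorm (x - r)) (enorm (x - q)).
  by apply: minp; rewrite inE.
exact: le_trans xqr.
Qed.

Lemma open_disjoint_frontier (T : topologicalType) (D : set T) (x : T) :
  open D -> D x -> ~ frontier D x.
Proof.
move=> oD Dx [_]; have -> // : closure (~` D) = ~` D.
by apply/esym/closure_id; rewrite -openC setCK.
Qed.

Lemma bdist_gt0 (R : realType) (n : nat) (D : set 'rV[R]_n) (x : 'rV[R]_n) :
  proper_domain D -> D x -> 0 < bdist D x.
Proof.
move=> hD Dx; have [p Fp <-] := bdist_attained x (frontier_nonempty hD).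
rewrite lt_neqAle enorm_ge0 andbT eq_sym; apply/eqP => /enorm_eq0/subr0_eq xp.
by case: hD => _ oD _ _; apply: (open_disjoint_frontier oD Dx); rewrite xp.
Qed.

(** The segment from [x] to a point outside [D] crosses the frontier, at a
point no farther from [x] than its endpoint. *)
Lemma eball_bdist_sub (R : realType) (n : nat) (D : set 'rV[R]_n)
    (x : 'rV[R]_n) : open D -> D x -> eball x (bdist D x) `<=` D.
Proof.
move=> oD Dx y xy; apply: contrapT => nDy.
have [s /andP[s0 s1] /(bdist_le x)] := segment_meets_frontier oD Dx nDy.
apply/negP; rewrite -ltNge enorm_ray (ger0_norm s0) enorm_distC.
by apply: le_lt_trans xy; rewrite ler_piMl// enorm_ge0.
Qed.

(** * Bounds on the Cassinian metric *)

Lemma ler_div_mul (R : realType) (s a b a' b' : R) : 0 <= s -> 0 < a -> 0 < b ->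
  a <= a' -> b <= b' -> s / (a' * b') <= s / (a * b).
Proof.
move=> s0 a0 b0 aa bb; rewrite ler_wpM2l//.
have a'0 := lt_le_trans a0 aa; have b'0 := lt_le_trans b0 bb.
by rewrite lef_pV2 ?posrE ?mulr_gt0// ler_pM// ltW.
Qed.

(** The supremum is bounded above because both denominators are bounded below by
the distances of [x] and [y] to the boundary; without this the total [sup] would
carry no information. *)
Lemma cassinian_ge (R : realType) (n : nat) (D : set 'rV[R]_n)
    (x y p : 'rV[R]_n) : proper_domain D -> D x -> D y -> frontier D p ->
  enorm (x - y) / (enorm (x - p) * enorm (p - y)) <= cassinian D x y.
Proof.
move=> hD Dx Dy Fp; apply: ub_le_sup; last by exists p.
exists (enorm (x - y) / (bdist D x * bdist D y)) => _ [q Fq <-].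
rewrite (enorm_distC q); apply: ler_div_mul; rewrite ?enorm_ge0 ?bdist_gt0//.
  exact: bdist_le.
exact: bdist_le.
Qed.

Lemma cassinian_le (R : realType) (n : nat) (D : set 'rV[R]_n)
    (x y : 'rV[R]_n) (a b : R) : frontier D !=set0 -> 0 < a -> 0 < b ->
    (forall p, frontier D p -> a <= enorm (x - p) /\ b <= enorm (p - y)) ->
  cassinian D x y <= enorm (x - y) / (a * b).
Proof.
move=> [q Fq] a0 b0 ab; apply: ge_sup.
  by eexists; exists q.
move=> _ [p Fp <-]; have [ap bp] := ab p Fp.
by apply: ler_div_mul; rewrite ?enorm_ge0.
Qed.

(** * The two inclusions and the inner radius *)

Lemma ltr_inner_radius (R : realType) (d t s : R) : 0 < d -> 0 < t -> s < d ->
  (s / (d * (d - s)) < t) = (s < inner_radius d t).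
Proof.
move=> d0 t0 sd; have td0 : 0 < t * d by rewrite mulr_gt0.
rewrite ltr_pdivrMr ?mulr_gt0 ?subr_gt0// ltr_pdivlMr; last by lra.
by apply/idP/idP; lra.
Qed.

Lemma ltr_outer_radius (R : realType) (d t s : R) : 0 < d -> 0 <= s ->
  0 < 1 - t * d ->
  (s / (d * (d + s)) < t) = (s < outer_radius d t).
Proof.
move=> d0 s0 td; rewrite ltr_pdivrMr; last by rewrite mulr_gt0// ltr_pwDl.
by rewrite ltr_pdivlMr//; apply/idP/idP; lra.
Qed.

Lemma inner_radius_lt (R : realType) (d t : R) : 0 < d -> 0 < t ->
  inner_radius d t < d.
Proof.
move=> d0 t0; have td0 : 0 < t * d by rewrite mulr_gt0.
rewrite ltr_pdivrMr; last lra.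
lra.
Qed.

Lemma inner_radius_gt0 (R : realType) (d t : R) : 0 < d -> 0 < t ->
  0 < inner_radius d t.
Proof.
by move=> d0 t0; rewrite divr_gt0 ?mulr_gt0 ?exprn_gt0// addr_gt0 ?mulr_gt0.
Qed.

Lemma eball_sub_cball (R : realType) (n : nat) (D : set 'rV[R]_n)
    (x : 'rV[R]_n) (t : R) : proper_domain D -> D x -> 0 < t ->
  eball x (inner_radius (bdist D x) t) `<=` cball D x t.
Proof.
move=> hD Dx t0 y xy; have d0 := bdist_gt0 hD Dx.
have xyd : enorm (x - y) < bdist D x := lt_trans xy (inner_radius_lt d0 t0).
split; first by case: hD => _ oD _ _; exact: eball_bdist_sub xyd.
move: xy; rewrite /eball/= -(ltr_inner_radius d0 t0 xyd) => xy.
apply: le_lt_trans xy; apply: cassinian_le => //.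
- exact: frontier_nonempty.
- by rewrite subr_gt0.
- move=> p Fp; split; first exact: bdist_le.
  rewrite lerBlDl; apply: le_trans (bdist_le x Fp) _.
  by rewrite (enorm_distC p); exact: enorm_triangle_dist.
Qed.

(** A single boundary point suffices, one nearest to [x]: it bounds the metric
from below by [s / (d (d + s))], with [s] the distance from [x] to [y]. *)
Lemma cball_sub_eball (R : realType) (n : nat) (D : set 'rV[R]_n)
    (x : 'rV[R]_n) (t : R) : proper_domain D -> D x ->
    0 < 1 - t * bdist D x ->
  cball D x t `<=` eball x (outer_radius (bdist D x) t).
Proof.
move=> hD Dx td y [Dy cxy]; have d0 := bdist_gt0 hD Dx.
have [p Fp xp] := bdist_attained x (frontier_nonempty hD).
have py0 : 0 < enorm (p - y).
  by rewrite enorm_distC; apply: lt_le_trans (bdist_le y Fp); exact: bdist_gt0.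
rewrite /eball/= -ltr_outer_radius ?enorm_ge0//.
apply: le_lt_trans cxy; apply: le_trans (cassinian_ge hD Dx Dy Fp).
rewrite xp; apply: ler_div_mul; rewrite ?enorm_ge0//.
by rewrite -xp (enorm_distC x p); exact: enorm_triangle_dist.
Qed.

(** Were [r'] larger than the inner radius [r], the point [y] at distance [r]
from [x] towards a nearest boundary point [p] would belong to the Cassinian
ball, although [p] alone already makes its Cassinian distance at least [t]. *)
Lemma inner_radius_best (R : realType) (n : nat) (D : set 'rV[R]_n)
    (x : 'rV[R]_n) (t r' : R) : proper_domain D -> D x -> 0 < t ->
  eball x r' `<=` cball D x t -> r' <= inner_radius (bdist D x) t.
Proof.
move=> hD Dx t0 sub; rewrite leNgt; apply/negP => rr'.
have d0 := bdist_gt0 hD Dx.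
have [p Fp xp] := bdist_attained x (frontier_nonempty hD).
have r0 := inner_radius_gt0 d0 t0; have rd := inner_radius_lt d0 t0.
set d := bdist D x in d0 xp rr' r0 rd *; set r := inner_radius d t in rr' r0 rd *.
pose y := x + (r / d) *: (p - x).
have xy : enorm (x - y) = r.
  by rewrite enorm_ray enorm_distC xp ger0_norm ?divfK ?gt_eqF// divr_ge0 ?ltW.
have py : enorm (p - y) = d - r.
  have -> : p - y = (1 - r / d) *: (p - x).
    by rewrite scalerBl scale1r /y opprD addrA.
  rewrite enormZ enorm_distC xp ger0_norm.
    by rewrite mulrBl mul1r divfK ?gt_eqF.
  by rewrite subr_ge0 ler_pdivrMr// mul1r ltW.
have [|Dy] := sub y; first by rewrite /eball/= xy.
apply/negP; rewrite -leNgt; apply: le_trans (cassinian_ge hD Dx Dy Fp).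
by rewrite xy xp py leNgt ltr_inner_radius// ltxx.
Qed.

(** * Sharpness of the outer radius in a half-space *)

Definition halfspace (R : realType) (n : nat) (i : 'I_n) : set 'rV[R]_n :=
  [set y | 0 < y ord0 i].

Lemma open_halfspace (R : realType) (n : nat) (i : 'I_n) :
  open (@halfspace R n i).
Proof.
apply: (@open_comp _ _ (fun y : 'rV[R]_n => y ord0 i) [set a | 0 < a]).
  by move=> y _; exact: coord_continuous.
exact: open_gt.
Qed.

(** A half-space is star-shaped about the unit vector [e]: it is a union of
segments that share the endpoint [e]. *)
Lemma connected_halfspace (R : realType) (n : nat) (i : 'I_n) :
  connected (@halfspace R n i).
Proof.
pose e : 'rV[R]_n := delta_mx ord0 i.
have -> : halfspace i = \bigcup_(y in halfspace i)
    [set e + s *: (y - e) | s in `[0, 1]].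
  apply/seteqP; split=> y.
    move=> Hy; exists y => //; exists 1; first by rewrite /= in_itv/= lexx ler01.
    by rewrite scale1r subrKC.
  move=> [z Hz [s + <-]]; rewrite /halfspace/= in_itv/= => /andP[s0 s1].
  have -> : (e + s *: (z - e)) ord0 i = (1 - s) + s * z ord0 i.
    by rewrite !mxE !eqxx /=; ring.
  move: s0; rewrite le_eqVlt => /predU1P[<-|s0]; first lra.
  by rewrite ltr_wpDl ?subr_ge0// mulr_gt0.
apply: bigcup_connected; last by move=> y _; exact: connected_segment.
exists e => y _; exists 0; first by rewrite /= in_itv/= lexx ler01.
by rewrite scale0r addr0.
Qed.

Lemma frontier_halfspace (R : realType) (n : nat) (i : 'I_n) (p : 'rV[R]_n) :
  frontier (halfspace i) p -> p ord0 i = 0.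
Proof.
move=> Fp; apply/eqP; rewrite eq_le; apply/andP; split.
  rewrite leNgt; apply/negP => Hp.
  exact: (open_disjoint_frontier (@open_halfspace R n i) Hp).
have cl : closed [set y : 'rV[R]_n | 0 <= y ord0 i].
  apply: (@preimage_closed _ _ (fun y : 'rV[R]_n => y ord0 i) [set a | 0 <= a]);
    last exact: closed_ge.
  by move=> y _; exact: coord_continuous.
case: Fp => Hp _; suff : [set y : 'rV[R]_n | 0 <= y ord0 i] p by [].
by move/closure_id: cl => ->; apply: closureS Hp => y /ltW.
Qed.

(** The segment from the unit vector down to the origin must meet the frontier,
and the origin is its only point with vanishing [i]-th coordinate. *)
Lemma halfspace_frontier0 (R : realType) (n : nat) (i : 'I_n) :
  frontier (@halfspace R n i) 0.
Proof.
have e1 : halfspace i (delta_mx ord0 i : 'rV[R]_n).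
  by rewrite /halfspace/= mxE !eqxx.
have n0 : ~ halfspace i (0 : 'rV[R]_n) by rewrite /halfspace/= mxE ltxx.
have [s _] := segment_meets_frontier (@open_halfspace R n i) e1 n0.
rewrite sub0r scalerN => Fp; move: (Fp) => /frontier_halfspace.
rewrite !mxE !eqxx /= mulr1 => /subr0_eq s1.
by move: Fp; rewrite -s1 scale1r subrr.
Qed.

Lemma proper_domain_halfspace (R : realType) (n : nat) (i : 'I_n) :
  proper_domain (@halfspace R n i).
Proof.
split.
- by exists (delta_mx ord0 i); rewrite /halfspace/= mxE !eqxx.
- exact: open_halfspace.
- exact: connected_halfspace.
- by apply/eqP => /seteqP[_ /(_ 0 Logic.I)]; rewrite /halfspace/= mxE ltxx.
Qed.

Lemma enorm_delta (R : realType) (n : nat) (i : 'I_n) :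
  enorm (delta_mx ord0 i : 'rV[R]_n) = 1.
Proof.
rewrite /enorm (bigD1 i)//= big1 => [|j ji].
  by rewrite addr0 mxE !eqxx expr1n sqrtr1.
by rewrite mxE (negbTE ji) andbF expr0n.
Qed.

Lemma frontier_halfspace_dist (R : realType) (n : nat) (i : 'I_n)
    (p y : 'rV[R]_n) :
  frontier (halfspace i) p -> y ord0 i <= enorm (y - p).
Proof.
move=> /frontier_halfspace p0.
have := ler_coord_enorm (y - p) i; rewrite !mxE p0 subr0.
exact/le_trans/ler_norm.
Qed.

Lemma bdist_halfspace (R : realType) (n : nat) (i : 'I_n) (d : R) : 0 < d ->
  bdist (halfspace i) (d *: delta_mx ord0 i) = d.
Proof.
move=> d0; apply/eqP; rewrite eq_le; apply/andP; split.
  apply: le_trans (bdist_le _ (halfspace_frontier0 R i)) _.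
  by rewrite subr0 enormZ enorm_delta mulr1 (ger0_norm (ltW d0)).
have [p Fp <-] := bdist_attained (d *: delta_mx ord0 i)
  (frontier_nonempty (proper_domain_halfspace R i)).
apply: le_trans (frontier_halfspace_dist _ Fp).
by rewrite !mxE !eqxx mulr1.
Qed.

(** For [0 <= s] below the outer radius, the point [y] at height [d + s] above
the hyperplane lies in the Cassinian ball at distance [s] from the centre, so a
Euclidean ball containing the Cassinian ball has radius greater than [s]. *)
Lemma outer_radius_best_halfspace (R : realType) (n : nat) (i : 'I_n)
    (d t R' : R) : 0 < d -> 0 < t -> 0 < 1 - t * d ->
  cball (halfspace i) (d *: delta_mx ord0 i) t
    `<=` eball (d *: delta_mx ord0 i) R' ->
  outer_radius d t <= R'.
Proof.
move=> d0 t0 td sub; rewrite leNgt; apply/negP => R'R.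
(* [R'] itself may be negative, and then the centre [s = 0] escapes the ball. *)
pose s := Num.max R' 0.
have s0 : 0 <= s by rewrite le_max lexx orbT.
have sR : s < outer_radius d t.
  rewrite gt_max R'R/=; apply: divr_gt0 => //.
  by rewrite mulr_gt0 ?exprn_gt0.
pose e : 'rV[R]_n := delta_mx ord0 i.
pose y := d *: e + s *: e.
have xy : enorm (d *: e - y) = s.
  by rewrite enorm_ray enorm_delta mulr1 ger0_norm.
have yi : y ord0 i = d + s by rewrite !mxE !eqxx !mulr1.
have := sub y; rewrite /eball/= xy; apply/not_implyP; split.
  split; first by rewrite /halfspace/= yi ltr_pwDl.
  move: sR; rewrite -ltr_outer_radius//; apply: le_lt_trans.
  rewrite -{1}xy; apply: cassinian_le => //.
  - by exists 0; exact: halfspace_frontier0.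
  - by rewrite ltr_pwDl.
  - move=> p Fp; split.
      by apply: le_trans (bdist_le _ Fp); rewrite bdist_halfspace.
    by rewrite enorm_distC -yi; exact: frontier_halfspace_dist.
by apply/negP; rewrite -leNgt le_max lexx.
Qed.

(** * Ratio of the radii *)

Lemma cvg_radius_ratio (R : realType) (d : R) : 0 < d ->
  outer_radius d t / inner_radius d t @[t --> 0^'+] --> (1 : R).
Proof.
move=> d0.
have lim : (1 + t * d) / (1 - t * d) @[t --> 0^'+] --> (1 : R).
  apply: cvg_at_right_filter.
  have td0 : t * d @[t --> 0] --> (0 : R).
    by rewrite -[X in _ --> X](mul0r d); apply: cvgMr_tmp; exact: cvg_id.
  have p1 : 1 + t * d @[t --> 0] --> (1 : R).
    by rewrite -[X in _ --> X]addr0; apply: cvgD => //; exact: cvg_cst.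
  have m1 : 1 - t * d @[t --> 0] --> (1 : R).
    by rewrite -[X in _ --> X]subr0; apply: cvgB => //; exact: cvg_cst.
  rewrite -[X in _ --> X]divr1; apply: cvgM => //; exact: cvgV m1.
apply: cvg_trans lim; apply: near_eq_cvg.
near=> t.
have t0 : 0 < t by near: t; exact: nbhs_right_gt.
have td0 : 0 < t * d by rewrite mulr_gt0.
have td : 0 < 1 - t * d.
  rewrite subr_gt0 -ltr_pdivlMr// mul1r; near: t.
  by apply: nbhs_right_lt; rewrite invr_gt0.
rewrite /outer_radius /inner_radius; field.
by rewrite !gt_eqF//; lra.
Unshelve. all: by end_near. Qed.

(** * Cassinian balls and Euclidean balls *)

Theorem theorem5p1 (R : realType) (n : nat) (hn : (2 <= n)%N)
    (D : set 'rV[R]_n) (hD : proper_domain D) (x : 'rV[R]_n) (hx : D x) :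
  (forall t : R, 0 < t -> 1 - t * bdist D x != 0 ->
    [/\ (* inner inclusion *)
        eball x (inner_radius (bdist D x) t) `<=` cball D x t,
        (* outer inclusion, whenever the outer radius is positive *)
        0 < 1 - t * bdist D x ->
          cball D x t `<=` eball x (outer_radius (bdist D x) t),
        (* the inner radius is best possible, in every domain *)
        forall r' : R, eball x r' `<=` cball D x t ->
          r' <= inner_radius (bdist D x) t
      & (* the outer radius is best possible as a function of the distance
           to the boundary and of t *)
        0 < 1 - t * bdist D x ->
          exists (D' : set 'rV[R]_n) (x' : 'rV[R]_n),
            [/\ proper_domain D', D' x', bdist D' x' = bdist D x
              & forall R' : R, cball D' x' t `<=` eball x' R' ->
                  outer_radius (bdist D x) t <= R']])
  /\ (outer_radius (bdist D x) t / inner_radius (bdist D x) t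
        @[t --> 0^'+] --> (1 : R)).
Proof.
have d0 := bdist_gt0 hD hx.
split; last exact: cvg_radius_ratio.
move=> t t0 _; split.
- exact: eball_sub_cball.
- exact: cball_sub_eball.
- by move=> r'; exact: inner_radius_best.
- move=> td; pose i : 'I_n := Ordinal (ltnW hn).
  exists (halfspace i), (bdist D x *: delta_mx ord0 i); split.
  + exact: proper_domain_halfspace.
  + by rewrite /halfspace/= !mxE !eqxx mulr1.
  + exact: bdist_halfspace.
  + by move=> R'; exact: outer_radius_best_halfspace.
Qed.
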